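(* $V_5=\displaystyle\inf_{a\in[1.6456659,\,2\cos\frac{\pi}{7}]}\frac{\chi_5(a)}{(\sqrt a-1)^2}$.
   Context: For an integer $n\ge 2$, $C_n$ denotes the set of real cosine polynomials $f(\phi)=\sum_{k=0}^{n} a_k\cos(k\phi)$ such that (i) all coefficients are real and nonnegative, (ii) $a_1>a_0>0$, and (iii) $f(\phi)\ge 0$ for all real $\phi$. For $f\in C_n$, $v(f)=\dfrac{f(0)-a_0}{(\sqrt{a_1}-\sqrt{a_0})^2}$ and $V_n=\inf_{f\in C_n}v(f)$. For $a\in\left(1,2\cos\frac{\pi}{n+2}\right]$, $\chi_n(a)=\inf\{f(0)-1 : f\in C_n,\ a_0(f)=1,\ a_1(f)=a\}$, where $a_k(f)$ is the $k$-th cosine coefficient of $f$. Numerical constants are decimal values as given in the paper, to seven decimal places. *)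

(* Defs.v *)
From HB Require Import structures.
From mathcomp Require Import all_boot all_order all_algebra.
From mathcomp Require Import all_classical all_reals all_analysis.

Set Implicit Arguments.
Unset Strict Implicit.
Unset Printing Implicit Defensive.

Import Order.TTheory GRing.Theory Num.Theory.

Local Open Scope classical_set_scope.
Local Open Scope ring_scope.

(* A cosine polynomial is represented by its sequence of cosine coefficients;
   the functions [cos (k * phi)] are linearly independent, so nothing is lost. *)
Definition cospoly (R : realType) (n : nat) (c : nat -> R) (phi : R) : R :=
  \sum_(k < n.+1) c k * cos (k%:R * phi).

(* The first clause makes the representation unique. *)
Definition cosC (R : realType) (n : nat) : set (nat -> R) :=
  [set c | [/\ forall k, (n < k)%N -> c k = 0,
               forall k, 0 <= c k,
               0 < c 0%N < c 1%N
             & forall phi : R, 0 <= cospoly n c phi]].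

Definition vratio (R : realType) (n : nat) (c : nat -> R) : R :=
  (cospoly n c 0 - c 0%N) / (Num.sqrt (c 1%N) - Num.sqrt (c 0%N)) ^+ 2.

Definition Vinf (R : realType) (n : nat) : R :=
  inf [set vratio n c | c in @cosC R n].

Definition chi (R : realType) (n : nat) (a : R) : R :=
  inf [set cospoly n c 0 - 1 | c in [set c | [/\ cosC n c, c 0%N = 1 & c 1%N = a]]].

(* Main.v *)
(* Normalise [a_0 = 1] and write [a = a_1]. Testing [f >= 0] at [pi] and at
   [2 pi / 3] bounds [f(0) - 1] below by [2 a - 1] and by [6 a - 7]; for
   [a <= 1.65] the larger of the two is at least [35.5 (sqrt a - 1)^2], while
   the polynomial [2 (4 cos phi + 1)^2 (cos phi + 1)^2] has [a = 80 / 47] and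
   [v < 35.5], so no [a] left of the interval matters. On the right, Fejer's
   inequality [a_1 <= 2 cos (pi / 7) a_0] and its extremal polynomial show that
   the interval contains exactly the remaining attainable values of [a]. *)
Require Import Defs.
From HB Require Import structures.
From mathcomp Require Import all_boot all_order all_algebra.
From mathcomp Require Import all_classical all_reals all_analysis.
From mathcomp Require Import ring lra.

Set Implicit Arguments.
Unset Strict Implicit.
Unset Printing Implicit Defensive.

Import Order.TTheory GRing.Theory Num.Theory.

Local Open Scope classical_set_scope.
Local Open Scope ring_scope.

(** * Multiple-angle formulas *)

Lemma cos2M (R : realType) (x : R) : cos (2 * x) = 2 * cos x ^+ 2 - 1.
Proof. by rewrite mulr_natl cos_mulr2n mulr_natl. Qed.

Lemma cos_succM (R : realType) (k : nat) (x : R) :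
  cos (k.+2%:R * x) = 2 * cos x * cos (k.+1%:R * x) - cos (k%:R * x).
Proof.
have -> : k.+2%:R * x = k.+1%:R * x + x by rewrite -[k.+2%:R]natr1; ring.
have -> : k%:R * x = k.+1%:R * x - x by rewrite -[k.+1%:R]natr1; ring.
by rewrite cosD cosB; ring.
Qed.

Lemma cos3M (R : realType) (x : R) : cos (3 * x) = 4 * cos x ^+ 3 - 3 * cos x.
Proof. by rewrite cos_succM mul1r cos2M; ring. Qed.

Lemma cos4M (R : realType) (x : R) :
  cos (4 * x) = 8 * cos x ^+ 4 - 8 * cos x ^+ 2 + 1.
Proof. by rewrite cos_succM cos3M cos2M; ring. Qed.

Lemma cos5M (R : realType) (x : R) :
  cos (5 * x) = 16 * cos x ^+ 5 - 20 * cos x ^+ 3 + 5 * cos x.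
Proof. by rewrite cos_succM cos4M cos3M; ring. Qed.

Lemma cospoly_at0 (R : realType) (n : nat) (c : nat -> R) :
  cospoly n c 0 = \sum_(k < n.+1) c k.
Proof. by apply: eq_bigr => k _; rewrite mulr0 cos0 mulr1. Qed.

Lemma cospoly5E (R : realType) (c : nat -> R) (phi : R) :
  cospoly 5 c phi = c 0%N + c 1%N * cos phi + c 2%N * cos (2 * phi) +
    c 3%N * cos (3 * phi) + c 4%N * cos (4 * phi) + c 5%N * cos (5 * phi).
Proof.
by rewrite /cospoly !big_ord_recr big_ord0 /= mul0r cos0 mul1r add0r mulr1.
Qed.

(** * Scaling invariance and normalisation *)

Lemma cosC_scale (R : realType) (n : nat) (c : nat -> R) (t : R) :
  0 < t -> cosC n c -> cosC n (fun k => t * c k).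
Proof.
move=> t0 [cn c0 /andP[c00 c01] cp]; split.
- by move=> k /cn ->; rewrite mulr0.
- by move=> k; rewrite mulr_ge0 ?c0 // ltW.
- by rewrite mulr_gt0 //= ltr_pM2l.
- move=> phi; have -> : cospoly n (fun k => t * c k) phi = t * cospoly n c phi.
    by rewrite /cospoly mulr_sumr; apply: eq_bigr => k _; rewrite mulrA.
  by rewrite mulr_ge0 ?cp // ltW.
Qed.

Lemma vratio_scale (R : realType) (n : nat) (c : nat -> R) (t : R) :
  0 < t -> vratio n (fun k => t * c k) = vratio n c.
Proof.
move=> t0; rewrite /vratio; set d := cospoly n _ 0.
have -> : d = t * cospoly n c 0.
  by rewrite /d /cospoly mulr_sumr; apply: eq_bigr => k _; rewrite mulrA.
rewrite !sqrtrM ?(ltW t0) // -!mulrBr exprMn sqr_sqrtr ?(ltW t0) //.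
by rewrite invfM mulrACA divff ?mul1r // gt_eqF.
Qed.

Lemma cosC_normalize (R : realType) (n : nat) (c : nat -> R) : cosC n c ->
  exists b, [/\ cosC n b, b 0%N = 1, b 1%N = c 1%N / c 0%N &
                vratio n b = vratio n c].
Proof.
move=> cc; have [_ _ /andP[c0 _] _] := cc.
have i0 : 0 < (c 0%N)^-1 by rewrite invr_gt0.
exists (fun k => (c 0%N)^-1 * c k); split.
- exact: cosC_scale.
- by rewrite mulVf // gt_eqF.
- by rewrite mulrC.
- exact: vratio_scale.
Qed.

Lemma cosC_at0_ge0 (R : realType) (n : nat) (c : nat -> R) :
  cosC n c -> 0 <= cospoly n c 0 - c 0%N.
Proof.
move=> [_ c0 _ _]; rewrite cospoly_at0 big_ord_recl /= addrC addKr.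
by apply: sumr_ge0 => i _; exact: c0.
Qed.

Lemma vratio_ge0 (R : realType) (n : nat) (c : nat -> R) :
  cosC n c -> 0 <= vratio n c.
Proof. by move=> cc; rewrite divr_ge0 ?sqr_ge0 // cosC_at0_ge0. Qed.

Lemma cosC_sqrt_gt1 (R : realType) (n : nat) (c : nat -> R) :
  cosC n c -> c 0%N = 1 -> 1 < Num.sqrt (c 1%N).
Proof.
move=> [_ _ /andP[c0 c1] _] e; rewrite e in c0 c1.
by rewrite -sqrtr1 ltr_sqrt // (lt_trans c0).
Qed.

(** * Elementary bounds on [chi] and [Vinf] *)

Lemma chi_le (R : realType) (n : nat) (c : nat -> R) :
  cosC n c -> c 0%N = 1 -> chi n (c 1%N) <= cospoly n c 0 - 1.
Proof.
move=> cc c0; apply: ge_inf; last by exists c.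
by exists 0 => _ [b [bc b0 _] <-]; rewrite -b0; exact: cosC_at0_ge0.
Qed.

Lemma chi_ge0 (R : realType) (n : nat) (a : R) : 0 <= chi n a.
Proof.
have [E0|En0] := pselect ([set cospoly n c 0 - 1 | c in
    [set c | [/\ cosC n c, c 0%N = 1 & c 1%N = a]]] !=set0).
  apply: lb_le_inf => // _ [b [bc b0 _] <-]; rewrite -b0; exact: cosC_at0_ge0.
(* For an unattainable [a] the infimum is over the empty set and takes the default value 0. *)
by rewrite /chi inf_out // => -[].
Qed.

(** Attainability of [a] ensures that [chi n a] is a genuine infimum and not the default 0. *)
Lemma Vinf_le_chi (R : realType) (n : nat) (a : R) :
  (exists c, [/\ cosC n c, c 0%N = 1 & c 1%N = a]) ->
  Vinf R n <= chi n a / (Num.sqrt a - 1) ^+ 2.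
Proof.
move=> [c [cc c0 c1]].
have s1 : 1 < Num.sqrt a by rewrite -c1; exact: cosC_sqrt_gt1 cc c0.
have d0 : 0 < (Num.sqrt a - 1) ^+ 2 by rewrite exprn_gt0 // subr_gt0.
rewrite ler_pdivlMr //; apply: lb_le_inf; first by exists (cospoly n c 0 - 1), c.
move=> _ [b [bc b0 b1] <-]; rewrite -ler_pdivlMr //.
apply: ge_inf; first by exists 0 => _ [e ec <-]; exact: vratio_ge0.
by exists b => //; rewrite /vratio b0 b1 sqrtr1.
Qed.

(** * The maximal ratio of [c 1] to [c 0] in degree five *)

Section Heptagon.
Variable R : realType.
Local Notation theta := (pi / 7 : R).

Lemma cos_2piB (x : R) : cos (2 * pi - x) = cos x.
Proof. by rewrite addrC mulr_natl cosD2pi cosN. Qed.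

Lemma cos_piB (x : R) : cos (pi - x) = - cos x.
Proof. by rewrite addrC cosDpi cosN. Qed.

(** Multiples of [3 * theta] fold back, up to sign, to [theta] and [5 * theta], so that values of a
    polynomial at these nodes become linear forms in few cosines. *)
Lemma cos_pi7_3theta :
  [/\ cos (2 * (3 * theta)) = - cos theta,
      cos (3 * (3 * theta)) = cos (5 * theta),
      cos (4 * (3 * theta)) = - cos (5 * theta)
    & cos (5 * (3 * theta)) = cos theta].
Proof.
split.
- by rewrite -cos_piB; congr cos; field.
- by rewrite -cos_2piB; congr cos; field.
- by rewrite -cos_2piB -cos_piB; congr cos; field.
- by rewrite -cos_2piB -cosN; congr cos; field.
Qed.

Lemma cos_pi7_5theta :
  [/\ cos (2 * (5 * theta)) = - cos (3 * theta),
      cos (3 * (5 * theta)) = cos theta,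
      cos (4 * (5 * theta)) = - cos theta
    & cos (5 * (5 * theta)) = cos (3 * theta)].
Proof.
split.
- by rewrite -cos_2piB -cos_piB; congr cos; field.
- by rewrite -cos_2piB -cosN; congr cos; field.
- by rewrite -cos_2piB -cos_piB -cosN; congr cos; field.
- by rewrite -cos_2piB -cosN -cos_2piB; congr cos; field.
Qed.

Lemma cos_pi7_gt : 1 < 2 * cos theta.
Proof.
have p := pi_gt0 R.
have y0 : 0 < cos theta by apply: cos_gt0_pihalf; lra.
have : 0 < cos (2 * theta) by apply: cos_gt0_pihalf; lra.
rewrite cos2M; nra.
Qed.

Lemma cos_5pi7 : cos (5 * theta) = 1 - 2 * cos theta ^+ 2.
Proof.
have -> : 5 * theta = pi - 2 * theta by field.
by rewrite cos_piB cos2M; ring.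
Qed.

Lemma cos_pi7_cubic :
  8 * cos theta ^+ 3 - 4 * cos theta ^+ 2 - 4 * cos theta + 1 = 0.
Proof.
have : cos (4 * theta) = - cos (3 * theta).
  by rewrite -cos_piB; congr cos; field.
rewrite cos4M cos3M => e; have y1 := cos_pi7_gt.
(* The quartic in [cos theta] given by [e] is [cos theta + 1] times the cubic. *)
have n0 : cos theta + 1 != 0 by rewrite gt_eqF //; lra.
by apply: (mulfI n0); rewrite mulr0; lra.
Qed.

Lemma cos_3pi7 : cos (3 * theta) = 2 * cos theta ^+ 2 - cos theta - 1 / 2.
Proof. by rewrite cos3M; have := cos_pi7_cubic; lra. Qed.

(* The weights are [cos (pi / 7) - cos phi] at the odd multiples [phi] of
   [pi / 7], which annihilate [cos (k phi)] for [k = 2, ..., 5]; the weight at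
   [pi / 7] itself vanishes. *)
Lemma cosC5_a1_le (c : nat -> R) : cosC 5 c -> c 1%N <= 2 * cos theta * c 0%N.
Proof.
move=> [_ _ _ cp]; have := cp pi; have := cp (3 * theta); have := cp (5 * theta).
rewrite !cospoly5E; have [-> -> -> ->] := cos_pi7_3theta.
have [-> -> -> ->] := cos_pi7_5theta.
rewrite cos_3pi7 cos_5pi7 cos5M cos4M cos3M cos2M cospi.
have := cos_pi7_cubic; have := cos_le1 theta; have := cos_pi7_gt.
move: (cos theta) => y y12 y1 y3.
set f5 := (X in 0 <= X -> _) => f5_ge0.
set f3 := (X in 0 <= X -> _) => f3_ge0.
set f7 := (X in 0 <= X -> _) => f7_ge0.
have p3 : 0 <= 2 * (y - (2 * y ^+ 2 - y - 1 / 2)) * f3.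
  by rewrite mulr_ge0 // mulr_ge0 //; nra.
have p5 : 0 <= 2 * (y - (1 - 2 * y ^+ 2)) * f5.
  by rewrite mulr_ge0 // mulr_ge0 //; nra.
have p7 : 0 <= (y + 1) * f7 by rewrite mulr_ge0 //; lra.
(* The nodes [3 * theta] and [5 * theta] count twice, for the angles and their negatives; [pi]
   counts once. Over all seven nodes the weighted sum is 7 y [c 0] - (7/2) [c 1], whence the factor
   2/7. As polynomials in [y] the two sides differ by a multiple of the cubic of [cos theta]. *)
suff <- : 2 / 7 * (2 * (y - (2 * y ^+ 2 - y - 1 / 2)) * f3 +
   2 * (y - (1 - 2 * y ^+ 2)) * f5 + (y + 1) * f7) +
   c 1%N = 2 * y * c 0%N by rewrite lerDr; lra.
apply/eqP; rewrite -subr_eq0.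
have -> : 2 / 7 * (2 * (y - (2 * y ^+ 2 - y - 1 / 2)) * f3 +
   2 * (y - (1 - 2 * y ^+ 2)) * f5 + (y + 1) * f7) + c 1%N - 2 * y * c 0%N =
   2 / 7 * y * (- 2 * c 1%N - c 2%N + c 3%N - c 4%N + c 5%N) *
   (8 * y ^+ 3 - 4 * y ^+ 2 - 4 * y + 1).
  by rewrite /f3 /f5 /f7; field.
by rewrite y3 mulr0.
Qed.

(* The coefficients of [|P(e^(i phi))|^2] for
   [P = 1 + z w + (z^2 - 1) w^2 + (z^2 - 1) w^3 + z w^4 + w^5], proportional to
   Fejer's extremal [\sum_k sin ((k + 1) pi / 7) w^k]. *)
Definition fejer7 (k : nat) : R :=
  let z := 2 * cos theta in
  match k with
  | 0 => 2 * (1 + z ^+ 2 + (z ^+ 2 - 1) ^+ 2)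
  | 1 => 2 * (2 * z ^+ 3 + (z ^+ 2 - 1) ^+ 2)
  | 2 => 4 * (z ^+ 2 - 1) * (1 + z)
  | 3 => 2 * (2 * (z ^+ 2 - 1) + z ^+ 2)
  | 4 => 4 * z
  | 5 => 2
  | _ => 0
  end.

Lemma fejer7_ratio : fejer7 1 = 2 * cos theta * fejer7 0.
Proof.
rewrite /fejer7; have y3 := cos_pi7_cubic; apply/eqP; rewrite -subr_eq0.
move: (cos theta) y3 => y y3.
have -> : 2 * (2 * (2 * y) ^+ 3 + ((2 * y) ^+ 2 - 1) ^+ 2) -
   2 * y * (2 * (1 + (2 * y) ^+ 2 + ((2 * y) ^+ 2 - 1) ^+ 2)) =
   (- 2 * (2 * y) ^+ 2 + 2) * (8 * y ^+ 3 - 4 * y ^+ 2 - 4 * y + 1).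
  by ring.
by rewrite y3 mulr0.
Qed.

Lemma fejer7_ge0 (k : nat) : 0 <= fejer7 k.
Proof.
have z1 := cos_pi7_gt.
case: k => [|[|[|[|[|[|k]]]]]] //=; move: (cos theta) z1 => y z1; try lra;
  try nra.
all: have := sqr_ge0 ((2 * y) ^+ 2 - 1); nra.
Qed.

Lemma fejer7_poly_ge0 (phi : R) : 0 <= cospoly 5 fejer7 phi.
Proof.
have y3 := cos_pi7_cubic.
rewrite cospoly5E /fejer7 cos5M cos4M cos3M cos2M.
have := cos_geN1 phi; move: (cos phi) => x x1.
move: (cos theta) y3 => y y3; set f := (X in 0 <= X).
(* [P] is palindromic of odd degree, hence 1 + w times a palindromic quartic: 2 + 2 x is |1 + w|^2,
   and the squared factor is the quartic divided by w^2, which is real on the unit circle. *)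
have -> : f = (2 + 2 * x) *
  (4 * x ^+ 2 + 2 * (2 * y - 1) * x + (2 * y) ^+ 2 - 2 * y - 2) ^+ 2.
  by rewrite /f; ring.
by rewrite mulr_ge0 ?sqr_ge0 //; lra.
Qed.

End Heptagon.

(** * Attainable values of [c 1] *)

Lemma cosC_shrink (R : realType) (n : nat) (b : nat -> R) (a : R) :
  cosC n b -> b 0%N = 1 -> 1 < a <= b 1%N ->
  exists c, [/\ cosC n c, c 0%N = 1 & c 1%N = a].
Proof.
move=> [bn b_ge0 _ bp] b0 /andP[a1 ab]; set t := a / b 1%N.
have b1 : 0 < b 1%N by lra.
have t01 : 0 <= t <= 1.
  by rewrite /t divr_ge0 ?(ltW b1) ?ler_pdivrMr ?mul1r //; lra.
(* A convex combination of [b] with the constant polynomial 1 keeps the constant term and scales the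
   other coefficients by [t]. *)
pose c k := t * b k + (1 - t) * (k == 0)%:R.
have c0 : c 0%N = 1 by rewrite /c b0 !mulr1; ring.
have c1 : c 1%N = a by rewrite /c mulr0 addr0 /t divfK // gt_eqF.
exists c; split=> //; split.
- by move=> [//|k] nk; rewrite /c bn // !mulr0 addr0.
- move=> k; have tb : 0 <= t * b k by rewrite mulr_ge0 //; lra.
  by rewrite /c; case: eqP => _ /=; lra.
- by rewrite c0 c1; lra.
move=> phi; have -> : cospoly n c phi = t * cospoly n b phi + (1 - t).
  have -> : 1 - t = \sum_(k < n.+1) (1 - t) * (val k == 0)%:R * cos (k%:R * phi).
    rewrite big_ord_recl /= mul0r cos0 !mulr1 big1 ?addr0 // => k _.
    by rewrite mulr0 mul0r.
  rewrite /cospoly mulr_sumr -big_split /=; apply: eq_bigr => k _.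
  by rewrite /c; ring.
by have := bp phi; nra.
Qed.

Lemma cosC5_exists (R : realType) (a : R) : 1 < a <= 2 * cos (pi / 7) ->
  exists c, [/\ cosC 5 c, c 0%N = 1 & c 1%N = a].
Proof.
have z1 := cos_pi7_gt R.
have f0 : 0 < fejer7 R 0 by rewrite /fejer7; nra.
have fC : cosC 5 (fejer7 R).
  split; [by do 6![case=> [//|]] | exact: fejer7_ge0 | | exact: fejer7_poly_ge0].
  by rewrite fejer7_ratio f0 ltr_pMl.
have [b [bC b0 b1 _]] := cosC_normalize fC.
by move=> az; apply: cosC_shrink bC b0 _; rewrite b1 fejer7_ratio mulfK // gt_eqF.
Qed.

(** * Values of [c 1] left of the interval, and the competitor *)

(* [f(pi) >= 0] *)
Lemma cosC5_lower1 (R : realType) (c : nat -> R) :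
  cosC 5 c -> c 0%N = 1 -> 2 * c 1%N - 1 <= cospoly 5 c 0 - 1.
Proof.
move=> [_ c_ge0 _ cp] c0; have := cp pi; rewrite !cospoly5E c0 !mulr0.
rewrite cos5M cos4M cos3M cos2M cospi cos0.
by have := c_ge0 3%N; have := c_ge0 5%N; lra.
Qed.

(* [3 f(pi) + 4 f(2 pi / 3) >= 0] *)
Lemma cosC5_lower2 (R : realType) (c : nat -> R) :
  cosC 5 c -> c 0%N = 1 -> 6 * c 1%N - 7 <= cospoly 5 c 0 - 1.
Proof.
move=> [_ c_ge0 _ cp] c0; have := cp pi; have := cp (acos (- (1 / 2))).
rewrite !cospoly5E c0 !mulr0 cos5M cos4M cos3M cos2M.
rewrite cos5M cos4M cos3M cos2M cospi cos0 acosK; last by rewrite in_itv /=; lra.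
(* The weights 3 and 4 give [c 2], [c 3] and [c 4] the coefficient 1, and [c 5] the coefficient
   -5. *)
by have := c_ge0 5%N; lra.
Qed.

Lemma vratio5_lower (R : realType) (c : nat -> R) :
  cosC 5 c -> c 0%N = 1 -> c 1%N <= 33 / 20 -> 71 / 2 <= vratio 5 c.
Proof.
move=> cc c0 ha; have s1 := cosC_sqrt_gt1 cc c0.
have l1 := cosC5_lower1 cc c0; have l2 := cosC5_lower2 cc c0.
rewrite /vratio c0 sqrtr1 ler_pdivlMr ?exprn_gt0 ?subr_gt0 //.
have c1 : 0 <= c 1%N by case: cc.
have := sqr_sqrtr c1; move: (Num.sqrt _) s1 => s s1 e.
(* For s >= 1 the bound 2 s^2 - 1 suffices up to about 1.242; 6 s^2 - 7 suffices from about 1.117 to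
   1.2898, beyond the square root of 33/20. The split 6/5 lies in the overlap. *)
have [s2|s2] := leP s (6 / 5); first by apply: le_trans l1; nra.
have s3 : s <= 129 / 100 by nra.
by apply: le_trans l2; nra.
Qed.

(* [2 (4 x + 1)^2 (x + 1)^2] with [x = cos phi] *)
Definition witness (R : realType) (k : nat) : R :=
  match k with
  | 0 => 47 | 1 => 80 | 2 => 49 | 3 => 20 | 4 => 4 | _ => 0
  end.

Lemma witness_cosC (R : realType) : cosC 5 (witness R).
Proof.
split; [by do 6![case=> [//|]] | by do 5![case=> //=] | rewrite /=; lra |].
move=> phi; rewrite cospoly5E cos5M cos4M cos3M cos2M /=.
set f := (X in 0 <= X).
have -> : f = 2 * ((4 * cos phi + 1) * (cos phi + 1)) ^+ 2 by rewrite /f; ring.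
by rewrite mulr_ge0 ?sqr_ge0.
Qed.

Lemma witness_vratio (R : realType) : vratio 5 (witness R) <= 71 / 2.
Proof.
rewrite /vratio cospoly_at0 !big_ord_recr big_ord0 /=.
set p := Num.sqrt 80; set q := Num.sqrt 47.
have p2 : p ^+ 2 = 80 by rewrite sqr_sqrtr //; lra.
have q2 : q ^+ 2 = 47 by rewrite sqr_sqrtr //; lra.
have pq0 : 0 <= p * q by rewrite mulr_ge0 ?sqrtr_ge0.
have pq2 : (p * q) ^+ 2 = 47 * 80 by rewrite exprMn p2 q2; ring.
(* 61.34 is just above the square root of 3760; the denominator is then at least 4.32, and 153 /
   4.32 < 35.5. *)
have pq : p * q <= 614 / 10 - 6 / 100 by nra.
have -> : (p - q) ^+ 2 = 127 - 2 * (p * q) by rewrite sqrrB p2 q2; ring.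
by rewrite ler_pdivrMr; lra.
Qed.

(** * Comparison of the two infima *)

Lemma inf_chi_le (R : realType) (n : nat) (l r : R) (c : nat -> R) :
  cosC n c -> l <= c 1%N / c 0%N <= r ->
  inf [set chi n a / (Num.sqrt a - 1) ^+ 2 | a in `[l, r]%classic]
    <= vratio n c.
Proof.
move=> cc lr; have [b [bC b0 b1 <-]] := cosC_normalize cc.
apply: (@le_trans _ _ (chi n (b 1%N) / (Num.sqrt (b 1%N) - 1) ^+ 2)).
  apply: ge_inf.
    by exists 0 => _ [a _ <-]; rewrite divr_ge0 ?sqr_ge0 ?chi_ge0.
  by exists (b 1%N) => //; rewrite /= in_itv /= b1.
rewrite /vratio b0 sqrtr1; apply: ler_wpM2r; first by rewrite invr_ge0 sqr_ge0.
exact: chi_le.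
Qed.

(* The left endpoint is 1.6456659, split so that no literal elaborates to a
   large unary natural number. *)
Theorem theorem5p1 (R : realType) :
  Vinf R 5 =
  inf [set chi 5 a / (Num.sqrt a - 1) ^+ 2
      | a in `[1 + 645 / 10 ^+ 3 + 665 / 10 ^+ 6 + 9 / 10 ^+ 7, 2 * cos (pi / 7)]%classic].
Proof.
set l := 1 + _ + _ + _.
have [l1 l2] : 1 < l /\ l <= 33 / 20 by rewrite /l; split; lra.
have a_le (c : nat -> R) : cosC 5 c -> c 1%N / c 0%N <= 2 * cos (pi / 7).
  move=> cc; have [_ _ /andP[c0 _] _] := cc.
  by rewrite ler_pdivrMr // cosC5_a1_le.
(* Besides placing 80/47 in the interval, this shows that the interval is nonempty, since [l] <
   80/47. *)
have w_le := a_le _ (witness_cosC R); rewrite /= in w_le.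
apply/eqP; rewrite eq_le; apply/andP; split.
  apply: lb_le_inf.
    exists (chi 5 l / (Num.sqrt l - 1) ^+ 2), l => //.
    by rewrite /= in_itv /= lexx; lra.
  move=> x [a /=]; rewrite in_itv /= => /andP[la ar] <-.
  by apply/Vinf_le_chi/cosC5_exists; rewrite ar (lt_le_trans l1).
apply: lb_le_inf.
  by exists (vratio 5 (witness R)), (witness R) => //; exact: witness_cosC.
move=> _ [c cc <-]; have [lc|cl] := leP l (c 1%N / c 0%N).
  by apply: inf_chi_le; rewrite // lc a_le.
apply: (@le_trans _ _ (71 / 2)).
  apply: le_trans (witness_vratio R); apply: inf_chi_le (witness_cosC R) _.
  by rewrite w_le /=; lra.
have [b [bC b0 b1 <-]] := cosC_normalize cc.
by apply: vratio5_lower; rewrite // b1; lra.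
Qed.
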